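(* Let $\{c_n\}_{n\ge1}$ be a real sequence, $\{d_{n+1}\}_{n\ge1}$ a positive chain sequence with minimal parameter sequence $\{\ell_{n+1}\}_{n\ge0}$, and let $P_0(x)=1$, $P_1(x)=x-c_1$, $P_{n+1}(x)=(x-c_{n+1})P_n(x)-d_{n+1}(x^2+1)P_{n-1}(x)$ for $n\ge1$. Let $\tau_0=1$, $\tau_n=\tau_{n-1}(1-ic_n)/(1+ic_n)$ for $n\ge1$, and let $\mu$ be the probability measure on the unit circle $\mathbb T$ whose Verblunsky coefficients are \[ \alpha_{n-1}=-\frac{1}{\tau_n}\,\frac{1-2\ell_{n+1}-ic_{n+1}}{1-ic_{n+1}},\qquad n\ge1 . \] For $k\ge1$ define, for $\zeta\ne1$ and $x=i(\zeta+1)/(\zeta-1)$ (equivalently $\zeta=(x+i)/(x-i)$), \[ \Phi_{k-1}(\zeta)=\frac{-i\,2^{k-1}}{\prod_{j=1}^k(1+ic_j)}\,\frac{1}{(x-i)^{k-1}}\Big[P_k(x)-(1-\ell_k)(x-i)P_{k-1}(x)\Big]. \] Then $\{\Phi_n\}_{n\ge0}$ are the monic orthogonal polynomials on the unit circle with respect to $\mu$, and they satisfy \[ \int_{\mathbb T}\overline{\Phi_m(\zeta)}\,\Phi_k(\zeta)\,d\mu(\zeta)=\frac{(1+c_1^2)\,2^{2k}\prod_{j=1}^{k+1}d_{j+1}}{\ell_{k+2}\prod_{j=1}^{k+1}(1+c_j^2)}\,\delta_{m,k},\qquad m,k\ge0 . \] Moreover, if $\{d_{n+1}\}_{n\ge1}$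 has multiple parameter sequences, then $\int_{\mathbb T}|\zeta-1|^{-2}\,d\mu(\zeta)$ is finite.
   Context: A sequence $\{d_{n+1}\}_{n\ge1}$ is a positive chain sequence if there is a parameter sequence $\{g_{n+1}\}_{n\ge0}$ with $0\le g_1<1$, $0<g_n<1$ for $n\ge2$, and $d_{n+1}=(1-g_n)g_{n+1}$ for $n\ge1$; the minimal parameter sequence $\{\ell_{n+1}\}_{n\ge0}$ is the one with $\ell_1=0$. The chain sequence has multiple parameter sequences if it admits more than one parameter sequence. For a nontrivial probability measure on $\mathbb T$ with monic orthogonal polynomials $\Phi_n$, the Verblunsky coefficients are $\alpha_n=-\overline{\Phi_{n+1}(0)}$, $n\ge0$. *)

(* Defs.v *)
From HB Require Import structures.
From mathcomp Require Import all_boot all_order all_algebra.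
From mathcomp Require Import complex.
From mathcomp Require Import all_classical all_reals all_analysis.

Set Implicit Arguments.
Unset Strict Implicit.
Unset Printing Implicit Defensive.

Import Order.TTheory GRing.Theory Num.Theory.
Local Open Scope ring_scope.
Local Open Scope complex_scope.

Section Defs.
Variable R : realType.
Local Notation C := R[i].

(* ---------- chain sequences ----------
   Sequences are functions nat -> R; only the indices used in the paper
   matter: d n for n >= 2 (i.e. d_{n+1}, n >= 1), g n for n >= 1. *)

Definition param_seq (d g : nat -> R) : Prop :=
  [/\ 0 <= g 1%N < 1,
      (forall n : nat, (2 <= n)%N -> 0 < g n < 1) &
      (forall n : nat, (1 <= n)%N -> d n.+1 = (1 - g n) * g n.+1)].

Definition positive_chain_seq (d : nat -> R) : Prop :=
  exists g, param_seq d g.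

Definition minimal_param_seq (d l : nat -> R) : Prop :=
  param_seq d l /\ l 1%N = 0.

Definition multiple_param_seqs (d : nat -> R) : Prop :=
  exists g1 g2, [/\ param_seq d g1, param_seq d g2 &
                    exists n : nat, (1 <= n)%N /\ g1 n <> g2 n].

Fixpoint Ppair (c d : nat -> R) (x : C) (n : nat) : C * C :=
  match n with
  | 0 => (1, x - (c 1%N)%:C)
  | n'.+1 =>
      let: (a, b) := Ppair c d x n' in
      (b, (x - (c n'.+2)%:C) * b - (d n'.+2)%:C * (x ^+ 2 + 1) * a)
  end.

Definition Pval (c d : nat -> R) (n : nat) (x : C) : C := (Ppair c d x n).1.

Fixpoint tau (c : nat -> R) (n : nat) : C :=
  match n with
  | 0 => 1
  | n'.+1 => tau c n' * (1 - 'i * (c n)%:C) / (1 + 'i * (c n)%:C)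
  end.

(* alpha_m  (m >= 0), i.e. alpha_{n-1} with n = m+1:
   alpha_{n-1} = -(1/tau_n) (1 - 2 l_{n+1} - i c_{n+1}) / (1 - i c_{n+1}) *)
Definition alpha_seq (c l : nat -> R) (m : nat) : C :=
  - (tau c m.+1)^-1 *
    ((1 - 2 * (l m.+2)%:C - 'i * (c m.+2)%:C) / (1 - 'i * (c m.+2)%:C)).

(* Right-hand side of the formula for Phi_{k-1}(zeta), with k = m+1,
   x = i (zeta + 1)/(zeta - 1)  (for zeta <> 1) *)
Definition Phi_formula (c d l : nat -> R) (m : nat) (zeta : C) : C :=
  let x := 'i * (zeta + 1) / (zeta - 1) in
  (- 'i * 2 ^+ m / \prod_(1 <= j < m.+2) (1 + 'i * (c j)%:C))
  * ((x - 'i) ^+ m)^-1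
  * (Pval c d m.+1 x - (1 - l m.+1)%:C * (x - 'i) * Pval c d m x).

Definition norm_const (c d l : nat -> R) (k : nat) : R :=
  ((1 + c 1%N ^+ 2) * 2 ^+ (2 * k) * \prod_(1 <= j < k.+2) d j.+1)
  / (l k.+2 * \prod_(1 <= j < k.+2) (1 + c j ^+ 2)).

(* ---------- measures on the unit circle ----------
   A probability measure on T is represented by a Borel probability
   measure mu on R concentrated on [0, 2 pi), via theta |-> e^{i theta}. *)
Definition eit (t : R) : C := (cos t) +i* (sin t).

Definition circle_measure (mu : probability R R) : Prop :=
  mu `[0, 2 * pi[%classic = 1%E.

Definition nontrivial (mu : probability R R) : Prop :=
  forall s : seq R, (mu [set t | t \in s]%classic < 1)%E.

Definition cint (mu : probability R R) (f : C -> C) : C :=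
  (Rintegral mu setT (fun t => @complex.Re R (f (eit t))))%:C
  + 'i * (Rintegral mu setT (fun t => @complex.Im R (f (eit t))))%:C.

Definition monic_OPUC (mu : probability R R) (Phi : nat -> {poly C}) : Prop :=
  forall n : nat,
    [/\ Phi n \is monic, size (Phi n) = n.+1 &
        forall j : nat, (j < n)%N ->
          cint mu (fun z => (z ^+ j)^* * (Phi n).[z]) = 0].

Definition has_verblunsky (mu : probability R R) (alpha : nat -> C) : Prop :=
  exists Phi : nat -> {poly C},
    monic_OPUC mu Phi /\ forall n : nat, alpha n = - ((Phi n.+1).[0])^*.

Definition inv_dist2 (z : C) : \bar R :=
  if z == 1 then +oo%E else ((Normc.normc (z - 1) ^+ 2)^-1)%:E.

End Defs.

(* Main.v *)
Require Import Defs.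
From HB Require Import structures.
From mathcomp Require Import all_boot all_order all_algebra.
From mathcomp Require Import complex.
From mathcomp Require Import all_classical all_reals all_analysis.
From mathcomp Require Import measurable_realfun ring lra.

(** Proof idea. Orthogonality gives the Szego recurrence for the monic
    orthogonal polynomials and their reversals; the explicit formula for
    [Phi_m], together with its reversal, satisfies the same recurrence, and
    1 - |alpha_n|^2 = 4 l_{n+2} (1 - l_{n+2}) / (1 + c_{n+2}^2) gives the norms.

    For the last claim, let lambda be a regularisation of
    q |-> int q(z) z / (1 - z) dmu on polynomials. The recurrence at z = 1
    becomes b_{n+1} = b_n + conj(alpha_n) conj(b_n) for b_n = lambda(Phi_n); a
    suitable choice of Im lambda(1) solves it as
    b_n = b_0 prod 2 l_j / (1 + i c_j), so that |b_n|^2 / ||Phi_n||^2 is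
    |b_0|^2 prod l_j / (1 - l_j). By Wall's argument these are summable when a
    parameter sequence with g_1 > 0 exists, i.e. lambda is bounded in L^2(mu).
    On s_j = 1 + z + ... + z^(j-1) one has -2 Re lambda(s_j) = ||s_j||^2, so the
    norms ||s_j|| are bounded, and since the Cesaro means of
    |s_j|^2 = |z^j - 1|^2 / |z - 1|^2 are eventually at least |z - 1|^(-2),
    Fatou's lemma concludes. *)

Set Implicit Arguments.
Unset Strict Implicit.
Unset Printing Implicit Defensive.

Import Order.TTheory GRing.Theory Num.Theory.
Import numFieldNormedType.Exports.

(* [ring_scope] is opened last so that ['i] and [^*] are those of
   [numClosedFieldType], as in the arguments of ring operations in Defs. *)
Local Open Scope complex_scope.
Local Open Scope ring_scope.

(** * Integration over the circle *)

Lemma complex_eqP (R : realType) (x y : R[i]) :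
  complex.Re x = complex.Re y -> complex.Im x = complex.Im y -> x = y.
Proof. by case: x => a b; case: y => a' b' /= -> ->. Qed.

Lemma complex_ReD (R : realType) (x y : R[i]) :
  complex.Re (x + y) = complex.Re x + complex.Re y.
Proof. by case: x; case: y. Qed.

Lemma complex_ImD (R : realType) (x y : R[i]) :
  complex.Im (x + y) = complex.Im x + complex.Im y.
Proof. by case: x; case: y. Qed.

Lemma complex_ReM (R : realType) (x y : R[i]) : complex.Re (x * y)
  = complex.Re x * complex.Re y - complex.Im x * complex.Im y.
Proof. by case: x; case: y. Qed.

Lemma complex_ImM (R : realType) (x y : R[i]) : complex.Im (x * y)
  = complex.Re x * complex.Im y + complex.Im x * complex.Re y.
Proof. by case: x; case: y. Qed.

Lemma complex_ReJ (R : realType) (x : R[i]) : complex.Re (x^*) = complex.Re x.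
Proof. by case: x. Qed.

Lemma complex_ImJ (R : realType) (x : R[i]) : complex.Im (x^*) = - complex.Im x.
Proof. by case: x. Qed.

Lemma eitJ (R : realType) (t : R) : (eit t)^* * eit t = 1.
Proof.
apply: complex_eqP; rewrite ?complex_ReM ?complex_ImM ?complex_ReJ ?complex_ImJ /=; last by ring.
by rewrite mulNr opprK -!expr2 cos2Dsin2.
Qed.

Section CircleIntegral.
Variables (R : realType) (mu : probability R R).
Local Notation C := R[i].

(** This class contains the polynomials, is closed under sums, products and conjugation, and
    consists of integrable functions, as linearity of [cint] requires. *)
Definition circle_bounded (f : C -> C) : Prop :=
  [/\ measurable_fun setT (fun t => complex.Re (f (eit t))),
      measurable_fun setT (fun t => complex.Im (f (eit t))) &
      exists M : R, forall t, `|complex.Re (f (eit t))| <= M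
                           /\ `|complex.Im (f (eit t))| <= M].

Lemma circle_bounded_cst (a : C) : circle_bounded (fun=> a).
Proof.
split; [exact: measurable_cst|exact: measurable_cst|].
exists (Num.max `|complex.Re a| `|complex.Im a|) => t.
by rewrite !le_max !lexx orbT.
Qed.

Lemma circle_bounded_id : circle_bounded id.
Proof.
split => /=.
- exact: continuous_measurable_fun (@continuous_cos R).
- exact: continuous_measurable_fun (@continuous_sin R).
- by exists 1 => t; rewrite cos_max sin_max.
Qed.

Lemma circle_boundedD (f g : C -> C) :
  circle_bounded f -> circle_bounded g -> circle_bounded (fun z => f z + g z).
Proof.
move=> [fr fi [M fM]] [gr gi [N gN]]; split.
- by under eq_fun do rewrite complex_ReD; exact: measurable_funD.
- by under eq_fun do rewrite complex_ImD; exact: measurable_funD.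
- exists (M + N) => t; have [? ?] := fM t; have [? ?] := gN t.
  by rewrite complex_ReD complex_ImD; split; apply: le_trans (ler_normD _ _) _; exact: lerD.
Qed.

Lemma circle_boundedM (f g : C -> C) :
  circle_bounded f -> circle_bounded g -> circle_bounded (fun z => f z * g z).
Proof.
move=> [fr fi [M fM]] [gr gi [N gN]]; split.
- under eq_fun do rewrite complex_ReM.
  by apply: measurable_funB; exact: measurable_funM.
- under eq_fun do rewrite complex_ImM.
  by apply: measurable_funD; exact: measurable_funM.
- exists (M * N + M * N) => t; have [? ?] := fM t; have [? ?] := gN t.
  rewrite complex_ReM complex_ImM; split;
    [apply: le_trans (ler_normB _ _) _|apply: le_trans (ler_normD _ _) _];
    by rewrite !normrM lerD// ler_pM.
Qed.

Lemma circle_boundedJ (f : C -> C) :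
  circle_bounded f -> circle_bounded (fun z => (f z)^*).
Proof.
move=> [fr fi [M fM]]; split.
- by under eq_fun do rewrite complex_ReJ.
- under eq_fun do rewrite complex_ImJ; exact: measurableT_comp.
- by exists M => t; rewrite complex_ReJ complex_ImJ normrN.
Qed.

Lemma circle_bounded_horner (p : {poly C}) : circle_bounded (fun z => p.[z]).
Proof.
elim/poly_ind: p => [|p a IH].
  by under eq_fun do rewrite horner0; exact: circle_bounded_cst.
under eq_fun do rewrite !hornerE.
apply: circle_boundedD; last exact: circle_bounded_cst.
apply: circle_boundedM => //; exact: circle_bounded_id.
Qed.

Lemma bounded_measurable_integrable (f : R -> R) (M : R) :
  measurable_fun setT f -> (forall t, `|f t| <= M) ->
  mu.-integrable setT (EFin \o f).
Proof.
move=> mf fM; apply: measurable_bounded_integrable => //.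
  by rewrite [X in (X < _)%E](@probability_setT _ _ _ mu) ltry.
exists M; split; first exact: num_real.
by move=> x Mx t _ /=; apply: le_trans (fM t) (ltW Mx).
Qed.

Lemma circle_bounded_integrable (f : C -> C) : circle_bounded f ->
  mu.-integrable setT (EFin \o (fun t => complex.Re (f (eit t)))) /\
  mu.-integrable setT (EFin \o (fun t => complex.Im (f (eit t)))).
Proof.
move=> [fr fi [M fM]]; split; apply: (@bounded_measurable_integrable _ M) => // t;
by case: (fM t).
Qed.

Lemma Re_cint (f : C -> C) :
  complex.Re (cint mu f) = Rintegral mu setT (fun t => complex.Re (f (eit t))).
Proof. by rewrite /cint -complexiE complex_ReD complex_ReM /= !mul0r mul1r subr0 addr0. Qed.

Lemma Im_cint (f : C -> C) :
  complex.Im (cint mu f) = Rintegral mu setT (fun t => complex.Im (f (eit t))).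
Proof. by rewrite /cint -complexiE complex_ImD complex_ImM /= !mul0r mul1r !add0r. Qed.

Lemma eq_cint (f g : C -> C) :
  (forall t, f (eit t) = g (eit t)) -> cint mu f = cint mu g.
Proof.
by move=> fg; apply: complex_eqP; rewrite ?Re_cint ?Im_cint;
  apply: eq_Rintegral => t _; rewrite fg.
Qed.

Lemma cintD (f g : C -> C) : circle_bounded f -> circle_bounded g ->
  cint mu (fun z => f z + g z) = cint mu f + cint mu g.
Proof.
move=> /circle_bounded_integrable[fr fi] /circle_bounded_integrable[gr gi].
apply: complex_eqP.
- rewrite [RHS]complex_ReD !Re_cint -RintegralD//.
  by apply: eq_Rintegral => t _; rewrite complex_ReD.
- rewrite [RHS]complex_ImD !Im_cint -RintegralD//.
  by apply: eq_Rintegral => t _; rewrite complex_ImD.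
Qed.

Lemma cintZ (a : C) (f : C -> C) : circle_bounded f ->
  cint mu (fun z => a * f z) = a * cint mu f.
Proof.
move=> /circle_bounded_integrable[fr fi].
have iZ (r : R) (h : R -> R) : mu.-integrable setT (EFin \o h) ->
    mu.-integrable setT (EFin \o (fun t => r * h t)).
  by move=> hi; exact: (integrableZl _ r hi).
apply: complex_eqP.
- rewrite [RHS]complex_ReM !Re_cint Im_cint -!RintegralZl// -RintegralB//; try exact: iZ.
  by apply: eq_Rintegral => t _; rewrite complex_ReM.
- rewrite [RHS]complex_ImM !Im_cint Re_cint -!RintegralZl// -RintegralD//; try exact: iZ.
  by apply: eq_Rintegral => t _; rewrite complex_ImM.
Qed.

Lemma cintJ (f : C -> C) : circle_bounded f ->
  cint mu (fun z => (f z)^*) = (cint mu f)^*.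
Proof.
move=> /circle_bounded_integrable[fr fi]; apply: complex_eqP.
- by rewrite complex_ReJ !Re_cint; apply: eq_Rintegral => t _; rewrite complex_ReJ.
- rewrite complex_ImJ !Im_cint -mulN1r -RintegralZl//.
  by apply: eq_Rintegral => t _; rewrite complex_ImJ mulN1r.
Qed.

Lemma cint1 : cint mu (fun=> 1) = 1.
Proof.
have mu1 : fine (mu setT) = 1 by rewrite [mu setT](@probability_setT _ _ _ mu).
by apply: complex_eqP; rewrite ?Re_cint ?Im_cint /= Rintegral_cst// mu1 mulr1.
Qed.

End CircleIntegral.

(** * Szego recurrence *)

Section InnerProduct.
Variables (R : realType) (mu : probability R R).
Local Notation C := R[i].

Definition ip (p q : {poly C}) : C := cint mu (fun z => (p.[z])^* * q.[z]).

Let bounded_ip (p q : {poly C}) : circle_bounded (fun z => (p.[z])^* * q.[z]).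
Proof.
by apply: circle_boundedM; [apply: circle_boundedJ|];
  exact: circle_bounded_horner.
Qed.

Lemma ipC (p q : {poly C}) : ip p q = (ip q p)^*.
Proof.
rewrite /ip -cintJ; last exact: bounded_ip.
by apply: eq_cint => t; rewrite rmorphM /= conjCK mulrC.
Qed.

Lemma ipDr (p q r : {poly C}) : ip p (q + r) = ip p q + ip p r.
Proof.
rewrite /ip -cintD; [|exact: bounded_ip..].
by apply: eq_cint => t; rewrite hornerD mulrDr.
Qed.

Lemma ipZr (a : C) (p q : {poly C}) : ip p (a *: q) = a * ip p q.
Proof.
rewrite /ip -cintZ; last exact: bounded_ip.
by apply: eq_cint => t; rewrite hornerZ mulrCA.
Qed.

Lemma ipBr (p q r : {poly C}) : ip p (q - r) = ip p q - ip p r.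
Proof. by rewrite ipDr -scaleN1r ipZr mulN1r. Qed.

Lemma ipDl (p q r : {poly C}) : ip (p + q) r = ip p r + ip q r.
Proof. by rewrite ipC ipDr rmorphD /= -!ipC. Qed.

Lemma ipZl (a : C) (p q : {poly C}) : ip (a *: p) q = a^* * ip p q.
Proof. by rewrite ipC ipZr rmorphM /= -ipC. Qed.

Lemma ip0l (p : {poly C}) : ip 0 p = 0.
Proof. by rewrite -(scale0r 0) ipZl conjC0 mul0r. Qed.

Lemma ip0r (p : {poly C}) : ip p 0 = 0.
Proof. by rewrite ipC ip0l conjC0. Qed.

Lemma ip11 : ip 1 1 = 1.
Proof.
rewrite -[RHS](cint1 mu); apply: eq_cint => t.
by rewrite hornerC conjC1 mulr1.
Qed.

(** Multiplication by z is an isometry because |z| = 1 on the circle. *)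
Lemma ipXX (p q : {poly C}) : ip ('X * p) ('X * q) = ip p q.
Proof.
apply: eq_cint => t; rewrite !hornerE rmorphM /= -!mulrA [_^* * (eit t * _)]mulrCA [LHS]mulrA.
by rewrite eitJ mul1r.
Qed.

Lemma ip_coef (n : nat) (p q : {poly C}) : (size p <= n)%N ->
  ip p q = \sum_(i < n) (p`_i)^* * ip 'X^i q.
Proof.
move=> pn; have {1}-> : p = \poly_(i < n) p`_i.
  apply/polyP => i; rewrite coef_poly; case: ltnP => // ni.
  by rewrite nth_default// (leq_trans pn).
rewrite poly_def (big_morph (ip^~ q) (fun p1 p2 => ipDl p1 p2 q) (ip0l q)).
by apply: eq_bigr => i _; rewrite ipZl.
Qed.

Lemma ip_lead (n : nat) (p q : {poly C}) :
  (forall j, (j < n)%N -> ip 'X^j q = 0) -> (size p <= n.+1)%N ->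
  ip p q = (p`_n)^* * ip 'X^n q.
Proof.
move=> q0 pn; rewrite (ip_coef _ pn) big_ord_recr/= big1 ?add0r// => i _.
by rewrite q0 ?mulr0.
Qed.

Lemma ip_orthogonal (n : nat) (p q : {poly C}) :
  (forall j, (j < n)%N -> ip 'X^j q = 0) -> (size p <= n)%N -> ip p q = 0.
Proof.
move=> q0 pn; rewrite (@ip_lead n) ?leqW//.
by rewrite nth_default// conjC0 mul0r.
Qed.

Lemma monic_OPUC_ip (Phi : nat -> {poly C}) (n j : nat) :
  monic_OPUC mu Phi -> (j < n)%N -> ip 'X^j (Phi n) = 0.
Proof.
move=> /(_ n)[_ _ H] jn; rewrite -[RHS](H _ jn).
by apply: eq_cint => t; rewrite hornerXn.
Qed.

End InnerProduct.

(** * Recurrence and norms from orthogonality *)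

Section Szego.
Variables (R : realType) (mu : probability R R).
Local Notation C := R[i].
Local Notation ip := (ip mu).
Variables (Phi : nat -> {poly C}) (a : nat -> C).
Hypothesis Phi_opuc : monic_OPUC mu Phi.
Hypothesis a_Phi : forall n : nat, a n = - ((Phi n.+1).[0])^*.
Hypothesis a_lt1 : forall n : nat, 1 - (a n)^* * a n != 0.

(* The reversed polynomials, as [szego] shows through [circle_reverse] *)
Fixpoint Phi_star (n : nat) : {poly C} :=
  match n with
  | 0 => 1
  | n'.+1 => Phi_star n' - a n' *: ('X * Phi n')
  end.

Definition sqnorm_Phi (n : nat) : C := \prod_(i < n) (1 - (a i)^* * a i).

Let Phi_monic n : Phi n \is monic. Proof. by case: (Phi_opuc n). Qed.
Let size_Phi n : size (Phi n) = n.+1. Proof. by case: (Phi_opuc n). Qed.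
Let Phi_orth n j : (j < n)%N -> ip 'X^j (Phi n) = 0.
Proof. exact: monic_OPUC_ip. Qed.
Let size_XPhi n : size ('X * Phi n) = n.+2.
Proof. by rewrite mulrC size_mulX ?size_Phi// -size_poly_eq0 size_Phi. Qed.

Lemma Phi0 : Phi 0%N = 1.
Proof.
have : (size (Phi 0%N) <= 1)%N by rewrite size_Phi.
move/size1_polyC => P0; rewrite P0; congr (_%:P).
by have := Phi_monic 0%N; rewrite monicE P0 lead_coefC coefC => /eqP.
Qed.

Lemma size_Phi_star n : (size (Phi_star n) <= n.+1)%N.
Proof.
elim: n => [|n IH] /=; first by rewrite size_poly1.
apply: leq_trans (size_polyD _ _) _; rewrite geq_max leqW//= size_polyN.
by apply: leq_trans (size_scale_leq _ _) _; rewrite size_XPhi.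
Qed.

Lemma Phi_star_horner0 n : (Phi_star n).[0] = 1.
Proof.
elim: n => [|n IH] /=; first by rewrite hornerC.
by rewrite !(hornerD, hornerN, hornerZ, hornerM, hornerX) IH mul0r mulr0 subr0.
Qed.

(** On the circle 1 / conj z = z, so this is the usual reversal z^n conj (Phi_n (1 / conj z)),
    stated where the integrals see it. *)
Definition circle_reverse (n : nat) : Prop := forall t : R,
  (Phi_star n).[eit t] = (eit t) ^+ n * ((Phi n).[eit t])^*.

Lemma ip_Xn_star (n j : nat) : circle_reverse n -> (j <= n)%N ->
  ip 'X^j (Phi_star n) = (ip 'X^(n - j) (Phi n))^*.
Proof.
move=> rn jn; rewrite [in RHS]ipC conjCK.
apply: eq_cint => t; rewrite rn !hornerXn mulrA.
have -> : (eit t ^+ j)^* * eit t ^+ n = eit t ^+ (n - j).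
  by rewrite -{1}(subnK jn) exprD rmorphXn /= mulrCA -exprMn eitJ expr1n mulr1.
by rewrite mulrC.
Qed.

Lemma ip_XnS_star (n : nat) : circle_reverse n ->
  ip 'X^(n.+1) (Phi_star n) = (ip 1 ('X * Phi n))^*.
Proof.
move=> rn; rewrite [in RHS]ipC conjCK.
apply: eq_cint => t; rewrite rn hornerXn hornerM hornerX hornerC mulr1 mulrA.
by rewrite rmorphXn exprS /= -[_ * _ * eit t ^+ n]mulrA -exprMn eitJ expr1n mulr1 rmorphM.
Qed.

(** The difference D of the two sides has degree at most n and vanishes at 0, so D = X E. Then E has
    degree below n and is orthogonal to 1, ..., X^(n-1), hence is 0. *)
Lemma szego_step (n : nat) : circle_reverse n ->
  (forall k, (k < n)%N -> ip 'X^k (Phi k) != 0) ->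
  Phi n.+1 = 'X * Phi n - (a n)^* *: Phi_star n.
Proof.
move=> rn Phi_neq0.
pose D := Phi n.+1 - 'X * Phi n + (a n)^* *: Phi_star n.
suff D0 : D = 0 by rewrite -[RHS]addr0 -D0 /D; ring.
have sD : (size D <= n.+1)%N.
  apply/leq_sizeP => j; rewrite leq_eqVlt !coefE => /orP[/eqP<-|nj].
    rewrite /= [(Phi_star n)`_ _]nth_default ?size_Phi_star// mulr0 addr0.
    have := Phi_monic n.+1; rewrite monicE lead_coefE size_Phi => /eqP ->.
    have := Phi_monic n; rewrite monicE lead_coefE size_Phi => /eqP /= ->.
    by rewrite subrr.
  rewrite [(Phi_star n)`_ _]nth_default ?(leq_trans (size_Phi_star n))// 1?ltnW//.
  rewrite [(Phi n.+1)`_ _]nth_default ?size_Phi//.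
  rewrite [(Phi n)`_ _]nth_default ?size_Phi//; last by case: j nj.
  by rewrite if_same mulr0 subrr addr0.
have /factor_theorem[E DE] : root D 0.
  apply/rootP; rewrite !(hornerD, hornerN, hornerZ, hornerM, hornerX) Phi_star_horner0 a_Phi.
  by rewrite rmorphN /= conjCK mul0r; ring.
rewrite subr0 in DE.
(* By [ipXX], pairing E with X^j is pairing D with X^(j+1). *)
have oE j : (j < n)%N -> ip 'X^j E = 0.
  move=> jn; rewrite -ipXX -exprS [_ * E]mulrC -DE ipDr ipBr ipZr.
  rewrite Phi_orth ?ltnS// exprS ipXX Phi_orth// -exprS ip_Xn_star//.
  by rewrite Phi_orth ?conjC0 ?mulr0 ?subr0 ?addr0// ltn_subrL (leq_ltn_trans _ jn).
suff E0 : E = 0 by rewrite DE E0 mul0r.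
apply/eqP/negP => /negP En0.
have sE : (size E <= n)%N.
  by move: sD; rewrite DE size_mulX.
(* In place of definiteness of [ip], E is paired with [Phi k] for k its degree: the value is 0, but
   also the conjugate leading coefficient times a nonzero number. *)
pose k := (size E).-1.
have sk : size E = k.+1 by rewrite /k prednK// lt0n size_poly_eq0.
have kn : (k < n)%N by rewrite -sk.
have : ip E (Phi k) = 0.
  by rewrite ipC (@ip_orthogonal _ _ n) ?conjC0 ?size_Phi.
rewrite (@ip_lead _ _ k) ?sk//; last by move=> j; exact: Phi_orth.
move/eqP; rewrite mulf_eq0 (negbTE (Phi_neq0 _ kn)) orbF conjC_eq0.
have -> : E`_k = lead_coef E by [].
by rewrite lead_coef_eq0 (negbTE En0).
Qed.

Lemma sqnorm_Phi_neq0 (n : nat) : sqnorm_Phi n != 0.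
Proof. by apply/prodf_neq0 => i _; exact: a_lt1. Qed.

(** The facts at n are premises so that this can be used inside the induction of [szego]. *)
Lemma ip_1_XPhi_rec (n : nat) : circle_reverse n ->
  Phi n.+1 = 'X * Phi n - (a n)^* *: Phi_star n ->
  ip 'X^n (Phi n) = sqnorm_Phi n ->
  ip 1 ('X * Phi n) = (a n)^* * (sqnorm_Phi n)^*.
Proof.
move=> rn En nn; have -> : 'X * Phi n = Phi n.+1 + (a n)^* *: Phi_star n.
  by rewrite En subrK.
by rewrite ipDr ipZr -(expr0 'X) Phi_orth// add0r ip_Xn_star// subn0 nn.
Qed.

(** The recurrence at n needs the reversal at n and nonzero norms below n; it then yields the
    reversal and the norm at n+1. Hence one strong induction for all three. *)
Lemma szego (n : nat) : [/\ circle_reverse n,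
  Phi n.+1 = 'X * Phi n - (a n)^* *: Phi_star n &
  ip 'X^n (Phi n) = sqnorm_Phi n].
Proof.
elim/ltn_ind: n => n IH.
have Phi_neq0 k : (k < n)%N -> ip 'X^k (Phi k) != 0.
  by move=> /IH[_ _ ->]; exact: sqnorm_Phi_neq0.
suff [rn nn] : circle_reverse n /\ ip 'X^n (Phi n) = sqnorm_Phi n.
  by split=> //; exact: szego_step.
case: n IH Phi_neq0 => [_ _|n IH Phi_neq0].
  split; first by move=> t; rewrite /= Phi0 !hornerC conjC1 mulr1.
  by rewrite Phi0 expr0 ip11 /sqnorm_Phi big_ord0.
have [rn En nn] := IH n (ltnSn n); split.
  move=> t; rewrite /= En !(hornerD, hornerN, hornerZ, hornerM, hornerX) rn.
  rewrite rmorphB !rmorphM /= conjCK rmorphXn /=.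
  rewrite exprS; set z := eit t; set p := (Phi n).[z].
  have -> : z * z ^+ n * (z^* * p^* - a n * (z^* ^+ n * p^*^*))
    = z ^+ n * ((z^* * z) * p^*) - a n * z * (z^*  * z) ^+ n * p^*^*.
    by rewrite exprMn; ring.
  by rewrite eitJ expr1n mulr1 mul1r conjCK mulrA.
rewrite {1}En ipBr ipZr exprS ipXX nn -exprS ip_XnS_star//.
rewrite (ip_1_XPhi_rec rn En nn).
rewrite rmorphM /= !conjCK /sqnorm_Phi big_ord_recr /=; ring.
Qed.

Lemma ip_1_XPhi (n : nat) : ip 1 ('X * Phi n) = (a n)^* * (sqnorm_Phi n)^*.
Proof. by have [rn En nn] := szego n; exact: ip_1_XPhi_rec. Qed.

Lemma Phi_orthogonal (m k : nat) :
  ip (Phi m) (Phi k) = if m == k then sqnorm_Phi k else 0.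
Proof.
have lt_orth i j : (i < j)%N -> ip (Phi i) (Phi j) = 0.
  move=> ij; apply: (@ip_orthogonal _ _ j); rewrite ?size_Phi//.
  by move=> ?; exact: Phi_orth.
case: ltngtP => [/lt_orth//|/lt_orth h|->]; first by rewrite ipC h conjC0.
rewrite (@ip_lead _ _ k) ?size_Phi//; last by move=> j; exact: Phi_orth.
have [_ _ ->] := szego k.
have := Phi_monic k; rewrite monicE lead_coefE size_Phi => /eqP /= ->.
by rewrite conjC1 mul1r.
Qed.

End Szego.

(** * Explicit coefficients *)

Section Verblunsky.
Variables (R : realType) (c d l : nat -> R).
Hypothesis hl : minimal_param_seq d l.
Local Notation C := R[i].
Local Notation alpha := (alpha_seq c l).

Lemma conjC_real_complex (r : R) : (r%:C)^* = r%:C.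
Proof. exact: conjc_real. Qed.

Lemma sqri : 'i * 'i = -1 :> C.
Proof. by rewrite -expr2 sqrCi. Qed.

Lemma add1i_neq0 (r : R) : 1 + 'i * r%:C != 0.
Proof. by rewrite -complexiE eq_complex /= mul0r mulr0 subrr addr0 oner_eq0. Qed.

Lemma sub1i_neq0 (r : R) : 1 - 'i * r%:C != 0.
Proof. by rewrite -complexiE eq_complex /= mul0r mulr0 subrr subr0 oner_eq0. Qed.

Lemma conjC_add1i (r : R) : (1 + 'i * r%:C)^* = 1 - 'i * r%:C.
Proof. by rewrite rmorphD rmorphM /= conjC1 conjCi conjC_real_complex mulNr. Qed.

Lemma conjC_sub1i (r : R) : (1 - 'i * r%:C)^* = 1 + 'i * r%:C.
Proof. by rewrite -conjC_add1i conjCK. Qed.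

Lemma prod_add1i_neq0 (m n : nat) : \prod_(m <= j < n) (1 + 'i * (c j)%:C) != 0.
Proof. by rewrite prodf_seq_neq0; apply/allP => i _ /=; exact: add1i_neq0. Qed.

Lemma prod_sub1i_neq0 (m n : nat) : \prod_(m <= j < n) (1 - 'i * (c j)%:C) != 0.
Proof. by rewrite prodf_seq_neq0; apply/allP => i _ /=; exact: sub1i_neq0. Qed.

Lemma tau_prod (n : nat) : tau c n = \prod_(1 <= j < n.+1) (1 - 'i * (c j)%:C)
  / \prod_(1 <= j < n.+1) (1 + 'i * (c j)%:C).
Proof.
elim: n => [|n IH]; first by rewrite !big_geq// divr1.
rewrite !(big_nat_recr n.+1)//= IH invfM.
by rewrite -!mulrA; congr (_ * _); rewrite mulrCA.
Qed.

Lemma tau_neq0 (n : nat) : tau c n != 0.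
Proof.
by rewrite tau_prod mulf_neq0// ?invr_eq0 ?prod_sub1i_neq0 ?prod_add1i_neq0.
Qed.

Lemma conjC_tau (n : nat) : (tau c n)^* = (tau c n)^-1.
Proof.
elim: n => [|n IH] /=; first by rewrite conjC1 invr1.
by rewrite !rmorphM fmorphV /= IH conjC_add1i conjC_sub1i !invfM invrK mulrAC.
Qed.

Lemma conjC_alpha (n : nat) : (alpha n)^* = - tau c n.+1 *
  ((1 - 2 * (l n.+2)%:C + 'i * (c n.+2)%:C) / (1 + 'i * (c n.+2)%:C)).
Proof.
rewrite /alpha_seq; have := conjC_tau n.+1; set t := tau c n.+1 => tJ.
rewrite 2!rmorphM rmorphN /= !fmorphV /= tJ invrK conjC_sub1i.
rewrite !rmorphB !rmorphM /= conjC1 conjCi !conjC_real_complex.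
by rewrite (_ : 2^* = 2) ?mulNr ?opprK// rmorph_nat.
Qed.

Lemma l_gt0 (n : nat) : 0 < l n.+2.
Proof. by have [[_ /(_ n.+2 isT)/andP[]]] := hl. Qed.

Lemma l_lt1 (n : nat) : l n.+1 < 1.
Proof.
have [[/andP[_ h1] h2 _] _] := hl.
by case: n => // n; have /andP[] := h2 n.+2 isT.
Qed.

Lemma d_param (n : nat) : d n.+2 = (1 - l n.+1) * l n.+2.
Proof. by have [[_ _ ->]] := hl. Qed.

Lemma add1sqr_gt0 (r : R) : 0 < 1 + r ^+ 2.
Proof. by rewrite ltr_wpDr// sqr_ge0. Qed.

Lemma add1sqrE (r : R) : (1 + r ^+ 2)%:C = (1 + 'i * r%:C) * (1 - 'i * r%:C).
Proof. by rewrite rmorphD rmorph1 rmorphXn /=; ring: sqri. Qed.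

Definition norm_ratio (n : nat) : R :=
  4 * l n.+2 * (1 - l n.+2) / (1 + c n.+2 ^+ 2).

Lemma norm_ratio_gt0 (n : nat) : 0 < norm_ratio n.
Proof.
rewrite divr_gt0 ?add1sqr_gt0//.
by rewrite !mulr_gt0 ?subr_gt0 ?l_lt1 ?l_gt0.
Qed.

(** The factors [tau] cancel, and (1 + c^2) - ((1 - 2 l)^2 + c^2) = 4 l (1 - l). *)
Lemma sub1_norm_alpha (n : nat) :
  1 - (alpha n)^* * alpha n = (norm_ratio n)%:C.
Proof.
rewrite conjC_alpha /alpha_seq /norm_ratio.
have t0 := tau_neq0 n.+1; set t := tau c n.+1 in t0 *.
rewrite rmorphM fmorphV /= add1sqrE !rmorphM rmorphB rmorph1 /=.
have -> : (4 : R)%:C = 4 by rewrite rmorph_nat.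
have := add1i_neq0 (c n.+2); have := sub1i_neq0 (c n.+2).
set u := (c n.+2)%:C; set v := (l n.+2)%:C => h1 h2.
rewrite -[LHS]mulr1 -[X in _ * X](divff (mulf_neq0 h2 h1)).
apply: (mulIf (mulf_neq0 h2 h1)).
rewrite -[RHS]mulrA mulVf ?mulr1 ?mulf_neq0//.
rewrite -[LHS]mulrA mulfVK ?mulf_neq0//.
transitivity ((1 + 'i * u) * (1 - 'i * u) - (t * t^-1)
   * ((1 + 'i * u)^-1 * (1 + 'i * u)) * ((1 - 'i * u)^-1 * (1 - 'i * u))
   * ((1 - 2 * v + 'i * u) * (1 - 2 * v - 'i * u))); first by ring.
by rewrite divff// !mulVf// !mul1r; ring.
Qed.

Lemma norm_const0 : norm_const c d l 0 = 1.
Proof.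
rewrite /norm_const muln0 expr0 mulr1 !big_nat1 d_param.
have [_ ->] := hl; rewrite subr0 mul1r [X in X / _]mulrC divff//.
by rewrite mulf_neq0 ?gt_eqF ?l_gt0 ?add1sqr_gt0.
Qed.

(** In the new factor d_(k+3) = (1 - l_(k+2)) l_(k+3), the second term cancels the new denominator,
    while the old denominator l_(k+2) is released. *)
Lemma norm_constS (k : nat) :
  norm_const c d l k.+1 = norm_const c d l k * norm_ratio k.
Proof.
rewrite /norm_const /norm_ratio !(big_nat_recr k.+2)//= mulnS exprD d_param.
have := gt_eqF (l_gt0 k); have := gt_eqF (l_gt0 k.+1).
have := gt_eqF (add1sqr_gt0 (c k.+2)).
have : \prod_(1 <= j < k.+2) (1 + c j ^+ 2) != 0.
  by rewrite prodf_seq_neq0; apply/allP => i _ /=; rewrite gt_eqF ?add1sqr_gt0.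
move=> h1 /negbT h2 /negbT h3 /negbT h4.
by field; do ?[apply/andP; split].
Qed.

Lemma norm_const_gt0 (k : nat) : 0 < norm_const c d l k.
Proof.
elim: k => [|k IH]; first by rewrite norm_const0.
by rewrite norm_constS mulr_gt0// norm_ratio_gt0.
Qed.

Lemma sqnorm_Phi_alpha (k : nat) : sqnorm_Phi alpha k = (norm_const c d l k)%:C.
Proof.
elim: k => [|k IH]; first by rewrite norm_const0 /sqnorm_Phi big_ord0.
rewrite norm_constS rmorphM /= -IH /sqnorm_Phi big_ord_recr /=.
by rewrite -sub1_norm_alpha.
Qed.

(** * Recurrence for the explicit formula *)

Lemma PvalSS (n : nat) (x : C) : Pval c d n.+2 x =
  (x - (c n.+2)%:C) * Pval c d n.+1 x
  - (d n.+2)%:C * (x ^+ 2 + 1) * Pval c d n x.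
Proof. by rewrite /Pval /=; case: (Ppair c d x n). Qed.

(* The reversal of [Phi_formula]: passing from [zeta] to [1 / zeta^*] conjugates
   [x], so that ['i] changes sign while the coefficients of [P_m] do not change. *)
Definition Phi_star_formula (m : nat) (zeta : C) : C :=
  let x := 'i * (zeta + 1) / (zeta - 1) in
  ('i * 2 ^+ m / \prod_(1 <= j < m.+2) (1 - 'i * (c j)%:C))
  * ((x - 'i) ^+ m)^-1
  * (Pval c d m.+1 x - (1 - l m.+1)%:C * (x + 'i) * Pval c d m x).

(** Makes x the free variable, so that identities in [zeta] become rational identities in x. *)
Lemma cayleyK (zeta : C) (x := 'i * (zeta + 1) / (zeta - 1)) : zeta != 1 ->
  x - 'i != 0 /\ zeta = (x + 'i) / (x - 'i).
Proof.
rewrite -subr_eq0 => z1.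
have E1 : x - 'i = 2 * 'i / (zeta - 1).
  by apply: (mulIf z1); rewrite mulrBl !mulfVK//; ring.
have E2 : x + 'i = 2 * 'i * zeta / (zeta - 1).
  by apply: (mulIf z1); rewrite mulrDl !mulfVK//; ring.
have x0 : x - 'i != 0.
  by rewrite E1 !mulf_neq0 ?invr_eq0 ?neq0Ci// pnatr_eq0.
split=> //; apply: (mulIf x0); rewrite mulfVK// E1 E2.
by rewrite mulrA [zeta * _]mulrC.
Qed.

(** Since l_1 = 0, the brackets are the constants i - c_1 and -i - c_1: x drops out, and [zeta = 1]
    is allowed. *)
Lemma Phi_formula0 (zeta : C) : Phi_formula c d l 0 zeta = 1
  /\ Phi_star_formula 0 zeta = 1.
Proof.
rewrite /Phi_formula /Phi_star_formula !expr0 !invr1 !mulr1 !big_nat1.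
rewrite /Pval /=; have [_ ->] := hl.
set x := _ / _; rewrite subr0 rmorph1 !mul1r.
have h1 := add1i_neq0 (c 1%N); have h2 := sub1i_neq0 (c 1%N).
split; [rewrite mulrAC; apply: (mulIf h1)|rewrite mulrAC; apply: (mulIf h2)];
  by rewrite mulfVK// mul1r; ring: sqri.
Qed.

(** Once P_(m+2) is expanded and d_(m+2) written through [l], both sides are linear in P_(m+1) and
    P_m, with x^2 + 1 = (x - i)(x + i). *)
Lemma Phi_formulaS (m : nat) (zeta : C) : zeta != 1 ->
  Phi_formula c d l m.+1 zeta = zeta * Phi_formula c d l m zeta
    - (alpha m)^* * Phi_star_formula m zeta
  /\ Phi_star_formula m.+1 zeta = Phi_star_formula m zeta
    - alpha m * (zeta * Phi_formula c d l m zeta).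
Proof.
move=> z1; rewrite conjC_alpha /alpha_seq tau_prod.
rewrite /Phi_formula /Phi_star_formula PvalSS !(big_nat_recr m.+2)//= d_param.
have := cayleyK z1; set x := 'i * (zeta + 1) / (zeta - 1).
case; move: x => x x0 ->.
have := prod_add1i_neq0 1 m.+2; have := prod_sub1i_neq0 1 m.+2.
set Q := \prod_(1 <= j < m.+2) (1 + 'i * (c j)%:C).
set Q' := \prod_(1 <= j < m.+2) (1 - 'i * (c j)%:C).
have := add1i_neq0 (c m.+2); have := sub1i_neq0 (c m.+2).
rewrite !(rmorphB, rmorphM, rmorph1) /=.
move: (Pval c d m.+1 x) (Pval c d m x) (c m.+2)%:C (l m.+2)%:C (l m.+1)%:C.
move=> P1 P0 u v v0 h1 h2 Q'0 Q0.
have := expf_neq0 m x0; rewrite !(exprS _ m).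
move: ((x - 'i) ^+ m) (2 ^+ m) => X T X0.
have i2 : ('i : C) * 'i = -1 by exact: sqri.
(* The imaginary unit becomes a variable subject to i * i = -1, the relation given to [field]. *)
move: ('i : C) i2 x0 h1 h2 => i i2 x0 h1 h2.
move: Q Q' Q0 Q'0 => Q Q' Q0 Q'0.
by split; field: i2; rewrite ?mulf_neq0 ?X0 ?x0 ?h1 ?h2 ?Q0 ?Q'0.
Qed.

(** With r_j = l_(j+2) / (1 - l_(j+2)), the positive quantities y_j = (1 - l_(j+1)) / (g_(j+1) -
    l_(j+1)) satisfy y_j = 1 + r_j y_(j+1). Unfolding y_0 = 1 / g_1 gives the partial sum plus a
    nonnegative remainder. *)
Lemma wall_partial_sum (g : nat -> R) (n : nat) :
  param_seq d g -> 0 < g 1%N ->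
  \sum_(k < n) \prod_(i < k) (l i.+2 / (1 - l i.+2)) <= (g 1%N)^-1.
Proof.
move=> [/andP[_ g1] g01 gd] g0.
(* The strict inequality 0 = l_1 < g_1 propagates through (1 - g_j) g_(j+1) = (1 - l_j) l_(j+1). *)
have lg j : l j.+1 < g j.+1.
  elim: j => [|j IH]; first by have [_ ->] := hl.
  have := gd j.+1 isT; rewrite d_param => E.
  have gj : g j.+1 < 1 by case: j {IH E} => // j; case/andP: (g01 j.+2 isT).
  have := l_gt0 j => l0.
  by nra.
have l1 j : 0 < 1 - l j.+1 by rewrite subr_gt0 l_lt1.
pose y j := (1 - l j.+1) / (g j.+1 - l j.+1).
have y0 j : 0 < y j by rewrite /y divr_gt0// subr_gt0.
have yS j : y j = 1 + l j.+2 / (1 - l j.+2) * y j.+1.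
  have := gd j.+1 isT; rewrite d_param /y => E.
  have n1 : g j.+1 - l j.+1 != 0 by rewrite gt_eqF ?subr_gt0.
  have n2 : g j.+2 - l j.+2 != 0 by rewrite gt_eqF ?subr_gt0.
  have n3 : 1 - l j.+2 != 0 by rewrite gt_eqF.
  move: E n1 n2 n3; set p := l j.+2; set q := g j.+2; set u := l j.+1.
  set v := g j.+1 => E n1 n2 n3.
  (* Both sequences produce the same d, so (1 - u)(q - p) = q (v - u). *)
  transitivity (q / (q - p)).
    by apply/eqP; rewrite eqr_div// mulrBr E -subr_eq0; apply/eqP; ring.
  by rewrite mulrA mulfVK//; apply: (mulIf n2); rewrite mulrDl mul1r !mulfVK// subrK.
have H m : y 0%N = \sum_(k < m) \prod_(i < k) (l i.+2 / (1 - l i.+2))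
   + \prod_(i < m) (l i.+2 / (1 - l i.+2)) * y m.
  elim: m => [|m IH]; first by rewrite !big_ord0 add0r mul1r.
  by rewrite IH big_ord_recr [in RHS]big_ord_recr /= yS mulrDr mulr1 -addrA mulrA.
have -> : (g 1%N)^-1 = y 0%N by rewrite /y; have [_ ->] := hl; rewrite !subr0 mul1r.
rewrite (H n) lerDl mulr_ge0 ?(ltW (y0 _))// prodr_ge0// => i _.
by rewrite divr_ge0 ?ltW ?l_gt0.
Qed.

End Verblunsky.

(** * The functional [cauchy1] *)

Section CauchyAtOne.
Variables (R : realType) (mu : probability R R).
Local Notation C := R[i].
Local Notation ip := (ip mu).
(** Plays the role of the integral of z / (1 - z). On the circle this function plus its conjugate is
    -1, whence [w_re]; the imaginary part stays free. *)
Variable w : C.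
Hypothesis w_re : w + w^* = -1.

(* A regularisation of the possibly divergent integral of q(z) z / (1 - z) *)
Definition cauchy1 (q : {poly C}) : C :=
  w * q.[1] - ip 1 ('X * (q %/ ('X - 1%:P))).

Lemma cauchy1D p q : cauchy1 (p + q) = cauchy1 p + cauchy1 q.
Proof. by rewrite /cauchy1 divpD hornerD !mulrDr ipDr; ring. Qed.

Lemma cauchy1Z a p : cauchy1 (a *: p) = a * cauchy1 p.
Proof. by rewrite /cauchy1 divpZl hornerZ -scalerAr ipZr; ring. Qed.

Lemma cauchy1B p q : cauchy1 (p - q) = cauchy1 p - cauchy1 q.
Proof. by rewrite cauchy1D -scaleN1r cauchy1Z mulN1r. Qed.

Lemma cauchy10 : cauchy1 0 = 0.
Proof. by rewrite -(scale0r 0) cauchy1Z mul0r. Qed.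

Lemma cauchy11 : cauchy1 1 = w.
Proof.
rewrite /cauchy1 divp_small ?size_poly1 ?size_XsubC//.
by rewrite mulr0 ip0r subr0 hornerC mulr1.
Qed.

(** Formally, z * z / (1 - z) = z / (1 - z) - z. *)
Lemma cauchy1X p : cauchy1 ('X * p) = cauchy1 p - ip 1 ('X * p).
Proof.
rewrite /cauchy1.
have -> : 'X * p = p * ('X - 1%:P) + p by rewrite mulrBr mulr1 subrK mulrC.
rewrite divpD mulpK ?polyXsubC_eq0// !hornerD hornerM hornerXsubC subrr mulr0.
by rewrite add0r mulrDr ipDr mulrBr mulr1 subrK [p * 'X]mulrC; ring.
Qed.

Definition geom (j : nat) : {poly C} := \sum_(i < j) 'X^i.

Lemma geomS j : geom j.+1 = 'X * geom j + 1.
Proof.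
rewrite /geom big_ord_recl addrC expr0 mulr_sumr; congr (_ + _).
by apply: eq_bigr => i _; rewrite exprS.
Qed.

(* Formally, 2 Re ((1 - z^j) / |1 - z|^2) = |1 - z^j|^2 / |1 - z|^2 on the circle *)
Lemma cauchy1_geom j :
  cauchy1 (geom j) + (cauchy1 (geom j))^* = - ip (geom j) (geom j).
Proof.
elim: j => [|j IH].
  by rewrite /geom big_ord0 cauchy10 ip0l conjC0 addr0 oppr0.
rewrite geomS cauchy1D cauchy1X cauchy11.
set g := geom j in IH *.
rewrite !(ipDl, ipDr) ipXX ip11 [ip ('X * g) 1]ipC rmorphD rmorphB /=.
transitivity ((cauchy1 g + (cauchy1 g)^*) + (w + w^*)
    - (ip 1 ('X * g) + (ip 1 ('X * g))^*)); first by ring.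
by rewrite IH w_re; ring.
Qed.

(** * The functional on the orthogonal polynomials and its norm *)

Section WithPhi.
Variables (Phi : nat -> {poly C}) (a : nat -> C).
Hypothesis Phi_opuc : monic_OPUC mu Phi.
Hypothesis a_Phi : forall n : nat, a n = - ((Phi n.+1).[0])^*.
Hypothesis a_lt1 : forall n : nat, 1 - (a n)^* * a n != 0.
Local Notation star := (Phi_star Phi a).
Local Notation kappa := (sqnorm_Phi a).

Lemma conjC_sqnorm_Phi n : (kappa n)^* = kappa n.
Proof.
rewrite /sqnorm_Phi rmorph_prod; apply: eq_bigr => i _ /=.
by rewrite rmorphB rmorphM /= conjC1 conjCK mulrC.
Qed.

(** Applying [cauchy1] to the Szego recurrence produces [cauchy1 (star n) + kappa n]. The first
    conjunct evaluates it and is carried along by induction, starting from [w_re]. *)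
Lemma cauchy1_Phi n :
  cauchy1 (star n) + kappa n = - (cauchy1 (Phi n))^* /\
  cauchy1 (Phi n.+1) = cauchy1 (Phi n) + (a n)^* * (cauchy1 (Phi n))^*.
Proof.
have XPhi m : cauchy1 ('X * Phi m) = cauchy1 (Phi m) - (a m)^* * kappa m.
  by rewrite cauchy1X (ip_1_XPhi Phi_opuc a_Phi a_lt1) conjC_sqnorm_Phi.
have step m : cauchy1 (star m) + kappa m = - (cauchy1 (Phi m))^* ->
    cauchy1 (Phi m.+1) = cauchy1 (Phi m) + (a m)^* * (cauchy1 (Phi m))^*.
  move=> H; have [_ -> _] := szego Phi_opuc a_Phi a_lt1 m.
  have -> : (cauchy1 (Phi m))^* = - (cauchy1 (star m) + kappa m).
    by rewrite H opprK.
  by rewrite cauchy1B cauchy1Z XPhi; ring.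
suff H : cauchy1 (star n) + kappa n = - (cauchy1 (Phi n))^*.
  by split=> //; exact: step.
elim: n => [|n IH].
  rewrite /= (Phi0 Phi_opuc) cauchy11 /sqnorm_Phi big_ord0.
  by rewrite -[1]opprK -w_re; ring.
rewrite (step _ IH) /= cauchy1B cauchy1Z XPhi.
have -> : cauchy1 (star n) = - (cauchy1 (Phi n))^* - kappa n.
  by rewrite -IH addrK.
have -> : (cauchy1 (Phi n) + (a n)^* * (cauchy1 (Phi n))^*)^*
    = (cauchy1 (Phi n))^* + a n * cauchy1 (Phi n).
  by rewrite rmorphD rmorphM /= !conjCK.
by rewrite /sqnorm_Phi big_ord_recr /=; ring.
Qed.

(* The Riesz representer of [cauchy1] on polynomials of size at most [n] *)
Definition riesz (n : nat) : {poly C} :=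
  \sum_(k < n) (((cauchy1 (Phi k))^* / kappa k) *: Phi k).

Lemma ip_riesz_r n p :
  ip p (riesz n) = \sum_(k < n) ((cauchy1 (Phi k))^* / kappa k) * ip p (Phi k).
Proof.
rewrite /riesz (big_morph (ip p) (ipDr mu p) (ip0r mu p)).
by apply: eq_bigr => k _; rewrite ipZr.
Qed.

Lemma ip_riesz_Phi n k : (k < n)%N -> ip (riesz n) (Phi k) = cauchy1 (Phi k).
Proof.
move=> kn; rewrite ipC ip_riesz_r (bigD1 (Ordinal kn))//= big1 ?addr0.
  rewrite (Phi_orthogonal Phi_opuc a_Phi a_lt1) eqxx mulfVK ?conjCK//.
  exact: sqnorm_Phi_neq0.
move=> i ik; rewrite (Phi_orthogonal Phi_opuc a_Phi a_lt1).
rewrite ifN ?mulr0//; apply: contra_neq ik => ik; exact: val_inj.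
Qed.

(** Induction on the degree: both sides agree on [Phi m], and subtracting its multiple by the top
    coefficient lowers the size. *)
Lemma ip_riesz n (q : {poly C}) : (size q <= n)%N -> ip (riesz n) q = cauchy1 q.
Proof.
move=> qn; suff H m (p : {poly C}) : (m <= n)%N -> (size p <= m)%N ->
    ip (riesz n) p = cauchy1 p by exact: (H n).
elim: m p => [|m IH] p mn.
  by rewrite size_poly_leq0 => /eqP ->; rewrite ip0r cauchy10.
move=> pm; have [Pm sP _] := Phi_opuc m.
have -> : p = (p - p`_m *: Phi m) + p`_m *: Phi m by rewrite subrK.
rewrite ipDr cauchy1D ipZr cauchy1Z ip_riesz_Phi// IH ?(ltnW mn)//.
apply/leq_sizeP => j; rewrite leq_eqVlt coefB coefZ => /orP[/eqP <-|mj].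
  by move: Pm; rewrite monicE lead_coefE sP => /eqP ->; rewrite mulr1 subrr.
by rewrite [p`_j]nth_default ?(leq_trans pm)// [(Phi m)`_j]nth_default ?sP// mulr0 subr0.
Qed.

(** Parseval: the squared norm of [cauchy1] on polynomials of size at most [n]. *)
Lemma ip_riesz_riesz n : ip (riesz n) (riesz n)
  = \sum_(k < n) (cauchy1 (Phi k))^* * cauchy1 (Phi k) / kappa k.
Proof.
by rewrite ip_riesz_r; apply: eq_bigr => k _; rewrite ip_riesz_Phi// mulrAC.
Qed.

Lemma size_geom j : (size (geom j) <= j)%N.
Proof.
elim: j => [|j IH]; first by rewrite /geom big_ord0 size_poly0.
rewrite geomS; apply: leq_trans (size_polyD _ _) _.
rewrite geq_max size_poly1 andbT.
by apply: leq_trans (size_polyMleq _ _) _; rewrite size_polyX.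
Qed.

Lemma Re_ip_ge0 p : 0 <= complex.Re (ip p p).
Proof.
rewrite Re_cint; apply: Rintegral_ge0 => t _.
by rewrite complex_ReM complex_ReJ complex_ImJ mulNr opprK -!expr2 addr_ge0// sqr_ge0.
Qed.

(* By [cauchy1_geom], 0 <= ||g + 2 r||^2 = 4 ||r||^2 - ||g||^2 for [g := geom j]
   and [r := riesz j]. *)
Lemma ip_geom_le j :
  complex.Re (ip (geom j) (geom j)) <= 4 * complex.Re (ip (riesz j) (riesz j)).
Proof.
rewrite -subr_ge0; set g := geom j; set r := riesz j.
have := Re_ip_ge0 (g + 2 *: r); congr (0 <= _).
have -> : ip (g + 2 *: r) (g + 2 *: r) = 4 * ip r r - ip g g.
  rewrite !(ipDl, ipDr, ipZl, ipZr) [ip g r]ipC ip_riesz ?size_geom//.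
  rewrite rmorph_nat.
  have -> : ip g g = - (cauchy1 g + (cauchy1 g)^*) by rewrite cauchy1_geom opprK.
  by ring.
have Re4 (z : C) : complex.Re (4 * z) = 4 * complex.Re z.
  by rewrite -[4 in LHS](rmorph_nat (real_complex R)) complex_ReM /= mul0r subr0.
have ReN (z : C) : complex.Re (- z) = - complex.Re z by case: z.
by rewrite complex_ReD Re4 ReN.
Qed.

End WithPhi.
End CauchyAtOne.

(** * Closed form and boundedness of the functional *)

Section Explicit.
Variables (R : realType) (mu : probability R R) (c d l : nat -> R).
Hypothesis hl : minimal_param_seq d l.
Local Notation C := R[i].
Local Notation alpha := (alpha_seq c l).
Variable Phi : nat -> {poly C}.
Hypothesis Phi_opuc : monic_OPUC mu Phi.
Hypothesis Phi_alpha : forall n : nat, alpha n = - ((Phi n.+1).[0])^*.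

Let alpha_lt1 n : 1 - (alpha n)^* * alpha n != 0.
Proof.
by rewrite sub1_norm_alpha fmorph_eq0 gt_eqF ?(norm_ratio_gt0 c hl).
Qed.

(* The imaginary part, which [w1_re] leaves free, is tuned so that
   [tau c n.+1 * (b n)^* = b n] in [cauchy1_PhiS]. *)
Definition w1 : C := - 2^-1 * (1 - 'i * (c 1%N)%:C).

Lemma w1_re : w1 + w1^* = -1.
Proof.
rewrite /w1 rmorphM /= conjC_sub1i rmorphN fmorphV rmorph_nat /=.
by field.
Qed.

Local Notation b n := (cauchy1 mu w1 (Phi n)).

(** The phase condition turns conj b_n into b_n / tau_(n+1), so the recurrence becomes
    multiplication by 1 - (1 - 2 l + i c) / (1 + i c) = 2 l / (1 + i c). This factor changes the
    phase exactly as [tau] requires. *)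
Lemma cauchy1_PhiS n : tau c n.+1 * (b n)^* = b n /\
  b n.+1 = b n * (2 * (l n.+2)%:C / (1 + 'i * (c n.+2)%:C)).
Proof.
have step m : tau c m.+1 * (b m)^* = b m ->
    b m.+1 = b m * (2 * (l m.+2)%:C / (1 + 'i * (c m.+2)%:C)).
  move=> H; have [_ ->] := cauchy1_Phi w1_re Phi_opuc Phi_alpha alpha_lt1 m.
  rewrite conjC_alpha mulrAC mulNr H.
  have := add1i_neq0 (c m.+2); set u := 'i * _ => u0.
  by field.
suff H : tau c n.+1 * (b n)^* = b n by split=> //; exact: step.
elim: n => [|n IH].
  rewrite (Phi0 Phi_opuc) cauchy11 /= mul1r /w1.
  rewrite rmorphM /= conjC_sub1i rmorphN fmorphV rmorph_nat /=.
  by have := add1i_neq0 (c 1%N); set u := 'i * _ => u0; field.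
rewrite (step _ IH) !rmorphM fmorphV /= conjC_add1i conjC_real_complex.
rewrite rmorph_nat; move: IH => /=; set T := tau c n * _ / _ => IH.
rewrite -{2}IH.
have := add1i_neq0 (c n.+2); have := sub1i_neq0 (c n.+2).
by set u := 'i * _ => u0 u1; field; rewrite u0 u1.
Qed.

(** Each step multiplies by 4 l^2 / (1 + c^2), which is [norm_ratio] times l / (1 - l); initially
    |w1|^2 = (1 + c_1^2) / 4. *)
Lemma sqr_cauchy1_Phi n : (b n)^* * b n = (norm_const c d l n *
  ((1 + c 1%N ^+ 2) / 4 * \prod_(i < n) (l i.+2 / (1 - l i.+2))))%:C.
Proof.
elim: n => [|n IH].
  rewrite (Phi0 Phi_opuc) cauchy11 norm_const0// big_ord0 mulr1 mul1r.
  rewrite [in RHS]rmorphM fmorphV /= add1sqrE rmorph_nat /w1.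
  rewrite rmorphM /= conjC_sub1i rmorphN fmorphV rmorph_nat /=.
  by field.
have [_ ->] := cauchy1_PhiS n.
have -> : (b n * (2 * (l n.+2)%:C / (1 + 'i * (c n.+2)%:C)))^*
    = (b n)^* * (2 * (l n.+2)%:C / (1 - 'i * (c n.+2)%:C)).
  by rewrite !rmorphM fmorphV /= conjC_add1i conjC_real_complex rmorph_nat.
rewrite mulrACA IH big_ord_recr /= norm_constS// /norm_ratio.
have -> : 2 * (l n.+2)%:C / (1 - 'i * (c n.+2)%:C)
     * (2 * (l n.+2)%:C / (1 + 'i * (c n.+2)%:C))
   = (4 * l n.+2 ^+ 2 / (1 + c n.+2 ^+ 2))%:C.
  rewrite rmorphM fmorphV /= add1sqrE rmorphM rmorph_nat rmorphXn /=.
  have := add1i_neq0 (c n.+2); have := sub1i_neq0 (c n.+2).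
  by set u := 'i * _ => u0 u1; field; rewrite u0 u1.
rewrite -rmorphM /=; congr (_%:C).
have h1 : 1 - l n.+2 != 0 by rewrite gt_eqF// subr_gt0 (l_lt1 hl).
have h2 : 1 + c n.+2 ^+ 2 != 0 by rewrite gt_eqF// add1sqr_gt0.
by field; rewrite h1 h2.
Qed.

Lemma ip_geom_bounded : multiple_param_seqs d ->
  exists K : R, forall j, complex.Re (ip mu (geom R j) (geom R j)) <= K.
Proof.
move=> [g1 [g2 [hg1 hg2 [n [n1 g12]]]]].
(* If both first parameters were 0, the relation defining d would force the two sequences to
   agree. *)
have [g [hg g0]] : exists g, param_seq d g /\ 0 < g 1%N.
  have [[/andP[+ _] _ _] [/andP[+ _] _ _]] := (hg1, hg2).
  rewrite le_eqVlt => /predU1P[e1|]; last by exists g1.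
  rewrite le_eqVlt => /predU1P[e2|]; last by exists g2.
  exfalso; apply: g12; case: n n1 => // n _.
  elim: n => [|n IH]; first by rewrite -e1 -e2.
  have [/andP[_ h1] h2 /(_ n.+1 isT)] := hg1.
  have [_ _ /(_ n.+1 isT) ->] := hg2; rewrite IH => /mulfI -> //.
  rewrite -IH gt_eqF// subr_gt0.
  by case: n {IH} => // n; have /andP[] := h2 n.+2 isT.
(* The 4 of [ip_geom_le], times |b_0|^2, times the bound of [wall_partial_sum]. *)
exists (4 * ((1 + c 1%N ^+ 2) / 4 * (g 1%N)^-1)) => j.
apply: le_trans (ip_geom_le w1_re Phi_opuc Phi_alpha alpha_lt1 j) _.
rewrite ler_pM2l// (ip_riesz_riesz w1 Phi_opuc Phi_alpha alpha_lt1).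
have -> : \sum_(k < j) (b k)^* * b k / sqnorm_Phi alpha k
    = ((1 + c 1%N ^+ 2) / 4
       * \sum_(k < j) \prod_(i < k) (l i.+2 / (1 - l i.+2)))%:C.
  rewrite mulr_sumr rmorph_sum; apply: eq_bigr => k _ /=.
  rewrite sqr_cauchy1_Phi (sqnorm_Phi_alpha c hl) -fmorphV -rmorphM /=.
  by rewrite mulrC mulKf// gt_eqF// (norm_const_gt0 c hl).
rewrite /= ler_pM2l ?divr_gt0 ?add1sqr_gt0//.
exact: (wall_partial_sum hl).
Qed.

End Explicit.

(** * The inverse squared distance *)

Section InverseDistance.
Variables (R : realType) (mu : probability R R).
Local Notation C := R[i].

Definition sqnormc (z : C) : R := complex.Re z ^+ 2 + complex.Im z ^+ 2.

Lemma sqnormc_ge0 z : 0 <= sqnormc z.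
Proof. by rewrite addr_ge0 ?sqr_ge0. Qed.

Lemma sqnormcM z z' : sqnormc (z * z') = sqnormc z * sqnormc z'.
Proof. by rewrite /sqnormc complex_ReM complex_ImM; ring. Qed.

Lemma sqnormc_gt0 z : z != 0 -> 0 < sqnormc z.
Proof.
move=> z0; rewrite lt_neqAle sqnormc_ge0 andbT eq_sym.
rewrite paddr_eq0 ?sqr_ge0// !sqrf_eq0.
by move: z0; rewrite eq_complex.
Qed.

Lemma Re_conjM (z : C) : complex.Re (z^* * z) = sqnormc z.
Proof.
by rewrite complex_ReM complex_ReJ complex_ImJ mulNr opprK -!expr2.
Qed.

Lemma sqr_normc_eq (z : C) : Normc.normc z ^+ 2 = sqnormc z.
Proof. by case: z => a b; rewrite /= sqr_sqrtr// addr_ge0 ?sqr_ge0. Qed.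

Lemma sqnormc_eit (t : R) : sqnormc (eit t) = 1.
Proof. by rewrite /sqnormc /= cos2Dsin2. Qed.

Lemma sqnormc_eitX (t : R) (n : nat) : sqnormc (eit t ^+ n) = 1.
Proof.
elim: n => [|n IH]; last by rewrite exprS sqnormcM IH sqnormc_eit mulr1.
by rewrite /sqnormc /= expr1n expr0n addr0.
Qed.

Definition sqgeom (j : nat) (t : R) : R := sqnormc (geom R j).[eit t].

Lemma geom_horner (j : nat) (z : C) : (geom R j).[z] * (z - 1) = z ^+ j - 1.
Proof.
elim: j => [|j IH]; first by rewrite /geom big_ord0 horner0 mul0r expr0 subrr.
rewrite geomS hornerD hornerM hornerX hornerC mulrDl -mulrA IH exprS; ring.
Qed.

Lemma sqgeomE (j : nat) (t : R) :
  sqgeom j t * sqnormc (eit t - 1) = 2 - 2 * complex.Re (eit t ^+ j).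
Proof.
rewrite /sqgeom -sqnormcM geom_horner.
have := sqnormc_eitX t j; case: (_ ^+ j) => x y; rewrite /sqnormc /= => h.
by rewrite subr0; lra.
Qed.

Lemma sum_Re_eitX (N : nat) (t : R) :
  \sum_(j < N) complex.Re (eit t ^+ j) = complex.Re (geom R N).[eit t].
Proof.
elim: N => [|N IH]; first by rewrite /geom !big_ord0 horner0.
by rewrite big_ord_recr /= IH /geom big_ord_recr hornerD hornerXn complex_ReD.
Qed.

(** After multiplication by D = |z - 1|^2 the sum is 2 N - 2 Re s_N, and 2 Re s_N <= 1 + |s_N|^2 <=
    1 + 4 / D <= N. *)
Lemma sum_sqgeom_ge (t : R) (N : nat) : eit t != 1 ->
  1 + 4 / sqnormc (eit t - 1) <= N%:R ->
  N%:R / sqnormc (eit t - 1) <= \sum_(j < N) sqgeom j t.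
Proof.
rewrite -subr_eq0 => /sqnormc_gt0; set D := sqnormc _ => D0 hN.
rewrite ler_pdivrMr// mulr_suml.
under eq_bigr do rewrite sqgeomE.
rewrite sumrB -mulr_sumr sum_Re_eitX sumr_const card_ord -[2 *+ N]mulr_natr.
set s := (geom R N).[_].
(* This is |z^N - 1| <= 2. *)
have : sqgeom N t <= 4 / D.
  rewrite ler_pdivlMr// sqgeomE.
  have := sqnormc_eitX t N; rewrite /sqnormc; set z := _ ^+ N => h.
  by have := sqr_ge0 (complex.Im z); nra.
rewrite /sqgeom /sqnormc -/s => hs.
have := sqr_ge0 (complex.Im s); have := sqr_ge0 (complex.Re s - 1).
by nra.
Qed.

(** Here |s_j|^2 = j^2 >= j. Quadratic growth makes the means diverge, matching the value of
    [inv_dist2] at 1. *)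
Lemma sum_sqgeom1_ge (t : R) (N : nat) : eit t = 1 ->
  N%:R * (N%:R - 1) / 2 <= \sum_(j < N) sqgeom j t.
Proof.
move=> t1.
have gj j : sqgeom j t = j%:R ^+ 2.
  rewrite /sqgeom; have -> : (geom R j).[eit t] = (j%:R : R)%:C.
    rewrite t1 rmorph_nat /geom horner_sum (eq_bigr (fun=> 1)).
      by rewrite sumr_const card_ord.
    by move=> i _; rewrite hornerXn expr1n.
  by rewrite /sqnormc /= expr0n addr0.
elim: N => [|N IH]; first by rewrite big_ord0 !mul0r.
rewrite big_ord_recr /= gj -natr1.
have : N%:R <= N%:R ^+ 2 :> R by rewrite -natrX ler_nat; case: (N) => // k; rewrite leq_pmulr.
by nra.
Qed.

Lemma measurable_sqgeom (j : nat) : measurable_fun setT (sqgeom j).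
Proof.
have [mr mi _] := circle_bounded_horner (geom R j).
by apply: measurable_funD; apply: measurable_funX.
Qed.

Lemma integral_sqgeom (j : nat) : (\int[mu]_t (sqgeom j t)%:E
  = (complex.Re (ip mu (geom R j) (geom R j)))%:E)%E.
Proof.
have gb : circle_bounded (fun z => (geom R j).[z]^* * (geom R j).[z]).
  by apply: circle_boundedM; [apply: circle_boundedJ|]; exact: circle_bounded_horner.
have [gi _] := circle_bounded_integrable mu gb.
rewrite Re_cint /Rintegral fineK; last exact: integrable_fin_num gi.
by apply: eq_integral => t _; rewrite Re_conjM.
Qed.

(** The integral of a nonnegative function is a supremum over simple functions below it, so
    [inv_dist2] can be compared without a measurability proof. *)
Lemma ge0_le_integralT (f g : R -> \bar R) :
  (forall t, (0 <= f t)%E) -> (forall t, (f t <= g t)%E) ->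
  (\int[mu]_t f t <= \int[mu]_t g t)%E.
Proof.
move=> f0 fg; rewrite !ge0_integralTE//; last first.
  by move=> t; exact: le_trans (f0 t) (fg t).
apply: ereal_sup_le => _ [h /= hf <-]; exists h => // t.
exact: le_trans (hf t) (fg t).
Qed.

Lemma le_limn_einf (u : (\bar R)^nat) (a : \bar R) (n : nat) :
  (forall k, (n <= k)%N -> (a <= u k)%E) -> (a <= limn_einf u)%E.
Proof.
move=> au; rewrite limn_einf_lim; apply: lime_ge; first exact: is_cvg_einfs.
exists n => // m /= nm; apply: le_ereal_inf_tmp => _ [k /= mk <-].
by apply: au; exact: leq_trans mk.
Qed.

Lemma limn_einf_le (u : (\bar R)^nat) (a : \bar R) :
  (forall k, (u k <= a)%E) -> (limn_einf u <= a)%E.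
Proof.
move=> ua; rewrite limn_einf_lim; apply: lime_le; first exact: is_cvg_einfs.
apply: nearW => n; apply: le_trans (ua n); apply: ereal_inf_lbound.
by exists n => /=.
Qed.

Lemma integral_inv_dist2_lty (K : R) :
  (forall j, complex.Re (ip mu (geom R j) (geom R j)) <= K) ->
  (\int[mu]_(t in setT) inv_dist2 (eit t) < +oo)%E.
Proof.
move=> geomK.
(* Cesaro means, because |s_j|^2 itself oscillates; [N.+1] keeps the divisor nonzero. *)
pose f N t := ((N.+1%:R^-1)%:E * \sum_(j < N.+1) (sqgeom j t)%:E)%E.
have f_ge0 N t : (0 <= f N t)%E.
  by rewrite mule_ge0// ?lee_fin// sume_ge0// => j _; rewrite lee_fin sqnormc_ge0.
have mf N : measurable_fun setT (f N).
  apply: measurable_funeM; apply: emeasurable_sum => j.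
  by apply/measurable_EFinP; exact: measurable_sqgeom.
have intf N : (\int[mu]_t f N t <= K%:E)%E.
  rewrite ge0_integralZl_EFin//; last 2 first.
  - by move=> t _; rewrite sume_ge0// => j _; rewrite lee_fin sqnormc_ge0.
  - by apply: emeasurable_sum => j; apply/measurable_EFinP; exact: measurable_sqgeom.
  rewrite ge0_integral_sum//; last 2 first.
  - by move=> j; apply/measurable_EFinP; exact: measurable_sqgeom.
  - by move=> j t _; rewrite lee_fin sqnormc_ge0.
  under eq_bigr do rewrite integral_sqgeom.
  rewrite sumEFin -EFinM lee_fin ler_pdivrMl//.
  apply: (@le_trans _ _ (\sum_(j < N.+1) K)); first by apply: ler_sum => j _.
  by rewrite sumr_const card_ord mulr_natl.
have fE N t : f N t = ((\sum_(j < N.+1) sqgeom j t) / N.+1%:R)%:E.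
  by rewrite /f sumEFin -EFinM mulrC.
apply: le_lt_trans (ltry K).
apply: (@le_trans _ _ (\int[mu]_t limn_einf (f^~ t))%E); last first.
  by apply: le_trans (fatou mu measurableT mf (fun N t _ => f_ge0 N t)) _; exact: limn_einf_le.
apply: ge0_le_integralT => t; rewrite /inv_dist2; case: eqP => [t1|/eqP t1].
- by rewrite leey.
- by rewrite lee_fin invr_ge0 sqr_ge0.
(* At z = 1 the mean of k+1 terms is at least k / 2, which exceeds any given A once k >= 2 A. *)
- rewrite leye_eq; apply/eqP/eqyP => A A0.
  apply: (@le_limn_einf _ _ (Num.bound (2 * A))) => k hk.
  rewrite fE lee_fin ler_pdivlMr//; apply: le_trans (sum_sqgeom1_ge _ t1).
  rewrite -natr1 addrK.
  have := archi_boundP (mulr_ge0 (ler0n R 2) (ltW A0)).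
  have : (Num.bound (2 * A))%:R <= k%:R :> R by rewrite ler_nat.
  by have : 0 <= k%:R :> R by []; nra.
- rewrite sqr_normc_eq; pose D := sqnormc (eit t - 1).
  have D0 : 0 < D by apply: sqnormc_gt0; rewrite subr_eq0.
  (* The threshold is the one in [sum_sqgeom_ge]. *)
  apply: (@le_limn_einf _ _ (Num.bound (1 + 4 / D))) => k hk.
  rewrite fE lee_fin ler_pdivlMr// mulrC; apply: sum_sqgeom_ge => //.
  have /ltW/le_trans := archi_boundP (addr_ge0 ler01 (ltW (divr_gt0 (ltr0n R 4) D0))).
  by apply; rewrite ler_nat; exact: leq_trans hk _.
Qed.

End InverseDistance.

(** * Agreement with the explicit formula, and conclusion *)

Lemma Phi_formula_horner (R : realType) (mu : probability R R)
    (c d l : nat -> R) (Phi : nat -> {poly R[i]}) :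
  minimal_param_seq d l -> monic_OPUC mu Phi ->
  (forall n : nat, alpha_seq c l n = - ((Phi n.+1).[0])^*) ->
  forall (m : nat) (zeta : R[i]), zeta != 1 ->
    (Phi m).[zeta] = Phi_formula c d l m zeta.
Proof.
move=> hl Phi_opuc Phi_alpha m zeta z1.
have alpha_lt1 n : 1 - (alpha_seq c l n)^* * alpha_seq c l n != 0.
  by rewrite sub1_norm_alpha fmorph_eq0 gt_eqF ?(norm_ratio_gt0 c hl).
(* The recurrence couples each polynomial with its reversal, so both equalities are proved
   together. *)
suff [] : (Phi m).[zeta] = Phi_formula c d l m zeta /\
  (Phi_star Phi (alpha_seq c l) m).[zeta] = Phi_star_formula c d l m zeta by [].
elim: m => [|m [IH1 IH2]].
  have [-> ->] := Phi_formula0 c hl zeta.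
  by rewrite /= (Phi0 Phi_opuc) !hornerC.
have [-> ->] := Phi_formulaS c hl m z1.
have [_ -> _] := szego Phi_opuc Phi_alpha alpha_lt1 m.
by rewrite /= !(hornerD, hornerN, hornerZ, hornerM, hornerX) IH1 IH2.
Qed.

Local Open Scope ring_scope.
Local Open Scope complex_scope.
Unset Implicit Arguments.

Theorem theorem3p2 (R : realType) (c d l : nat -> R)
    (hd : positive_chain_seq d) (hl : minimal_param_seq d l)
    (mu : probability R R) (hT : circle_measure mu) (hnt : nontrivial mu)
    (hV : has_verblunsky mu (alpha_seq c l)) :
  exists Phi : nat -> {poly R[i]},
    [/\ monic_OPUC mu Phi,
        (forall (m : nat) (zeta : R[i]), zeta != 1 ->
            (Phi m).[zeta] = Phi_formula c d l m zeta),
        (forall m k : nat,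
            cint mu (fun z => ((Phi m).[z])^* * (Phi k).[z])
            = (if m == k then norm_const c d l k else 0)%:C) &
        (multiple_param_seqs d ->
            (\int[mu]_(t in setT) inv_dist2 (eit t) < +oo)%E)].
Proof.
have [Phi [Phi_opuc Phi_alpha]] := hV.
have alpha_lt1 n : (1 - (alpha_seq c l n)^* * alpha_seq c l n != 0)%R.
  by rewrite sub1_norm_alpha fmorph_eq0 gt_eqF ?(norm_ratio_gt0 c hl).
exists Phi; split=> //.
- exact: Phi_formula_horner.
- move=> m k; have := Phi_orthogonal Phi_opuc Phi_alpha alpha_lt1 m k.
  rewrite /ip => ->; case: eqP => // _.
  exact: sqnorm_Phi_alpha.
- move=> /(ip_geom_bounded hl Phi_opuc Phi_alpha)[K geomK].
  exact: integral_inv_dist2_lty geomK.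
Qed.
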